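(* Let $\gamma\in[0,1]$ and let $0\le T_{\min}\le T_{\max}$ be integers. Consider a slotted network of capacity $C$ requests per slot ($C$ a positive integer), with i.i.d. Poisson arrivals of rate $\lambda=C^{\gamma}$ per slot, operated under the earliest-deadline-first policy, in which the lookahead times of the requests are i.i.d. nonnegative integer-valued random variables, each distributed as a random variable $\tau$ with $$\Pr(\tau=k)=\begin{cases}p_k, & T_{\min}\le k\le T_{\max},\\ 0, & \text{otherwise,}\end{cases}$$ where the probabilities $p_k$ are constants that do not depend on $C$, and $p_{T_{\min}}>0$. Let $P_P(\text{outage})$ be the steady-state outage probability of this network. Then its diversity gain is $$d_P(\gamma)=\lim_{C\to\infty}\frac{-\log P_P(\text{outage})}{C\log C}=(1+T_{\min})(1-\gamma).$$
   Context: Model. Time is slotted, $n=1,2,\dots$. At the beginning of slot $n$, $Q(n)$ requests arrive; the $Q(n)$ are i.i.d. Poisson random variables with mean $\lambda$. Each request needs exactly one unit of resource and is served entirely within one slot. The network has a fixed capacity of $C$ units per slot, i.e. it can serve at most $C$ requests in each slot. The system starts empty. Deadlines. Each request is assigned upon arrival its own lookahead time; the lookahead times are i.i.d. across requests and independent of the arrival process. A request arriving at the beginning of slot $n$ with lookahead time $t$ has deadline slot $n+t$: it can be served in any of the slots $n,\dots,n+t$. If it has not been served by the end of slot $n+t$, it expires in slot $n+t$ and leaves the system. Scheduling. Service follows the earliest-deadline-first (EDF) policy: in every slot the network serves as many of the requests present in the system as the capacity allows (all of them if there are at most $C$, otherwise $C$ of them), giving priority to requests with the earliest deadlines. Lookahead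 times of requests already in the system are known to the scheduler. Outage. An outage occurs in slot $n$ if and only if at least one request expires in slot $n$. $P_P(\text{outage})$ is the steady-state probability of outage, i.e. the limit as $n\to\infty$ of the probability that an outage occurs in slot $n$. Scaling and diversity gain. The arrival rate scales with capacity as $\lambda=C^{\gamma}$ with $\gamma\in[0,1]$ fixed, and the diversity gain is $d_P(\gamma)=\lim_{C\to\infty}\frac{-\log P_P(\text{outage})}{C\log C}$. *)

(* Defs.v *)
From HB Require Import structures.
From mathcomp Require Export all_boot all_order all_algebra.
From mathcomp Require Export all_classical all_reals all_analysis.
Export Order.TTheory GRing.Theory Num.Theory.
Export numFieldNormedType.Exports.

Set Implicit Arguments.
Unset Strict Implicit.
Unset Printing Implicit Defensive.

Local Open Scope classical_set_scope.
Local Open Scope ring_scope.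

(* EDF queue of capacity C along one sample path.  A request is represented by
   its deadline: requests with equal deadlines are interchangeable for EDF and
   for the occurrence of an outage, so tie-breaking is immaterial.
   [arr n] lists the deadlines of the requests arriving at the beginning of
   slot n, for n = 1, 2, ...; [arr 0] is never used.
   [edf_unserved C arr n] lists the deadlines of the requests not served by the
   end of slot n, just before those with deadline n expire; slot 0 stands for
   the empty initial state. *)
Fixpoint edf_unserved (C : nat) (arr : nat -> seq nat) (n : nat) : seq nat :=
  if n is m.+1 then
    drop C (sort leq ([seq t <- edf_unserved C arr m | (m < t)%N] ++ arr n))
  else [::].

Definition outage (C : nat) (arr : nat -> seq nat) (n : nat) : bool :=
  n \in edf_unserved C arr n.

(* The i-th request of slot n, for i < q n, has lookahead time t n i. *)
Definition deadlines (q : nat -> nat) (t : nat -> nat -> nat) (n : nat) :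
    seq nat :=
  [seq (n + t n i)%N | i <- iota 0 (q n)].

Definition mutually_independent d (T : measurableType d) (R : realType)
    (P : probability T R) d' (T' : measurableType d') (I : eqType)
    (X : I -> {RV P >-> T'}) : Prop :=
  forall (s : seq I) (A : I -> set T'), uniq s ->
    (forall i, measurable (A i)) ->
    P (\bigcap_(i in [set` s]) (X i @^-1` A i)) =
      (\prod_(i <- s) P (X i @^-1` A i))%E.

(* Q n is the number of requests of slot n and tau n i the lookahead time of
   the i-th of them.  tau n i is defined for every i, although only the values
   with i < Q n are used.  Slots start at 1, hence the indices n.+1. *)
Definition iid_poisson_requests d (T : measurableType d) (R : realType)
    (P : probability T R) (lambda : R) (pmf : nat -> R)
    (Q : nat -> {RV P >-> nat}) (tau : nat -> nat -> {RV P >-> nat}) : Prop :=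
  [/\ forall n k, P (Q n.+1 @^-1` [set k]) = (poisson_pmf lambda k)%:E,
      forall n i k, P (tau n.+1 i @^-1` [set k]) = (pmf k)%:E
    & mutually_independent (fun z : nat + nat * nat =>
        match z with
        | inl n => Q n.+1
        | inr (n, i) => tau n.+1 i
        end)].

Definition outage_prob d (T : measurableType d) (R : realType)
    (P : probability T R) (C : nat)
    (Q : nat -> {RV P >-> nat}) (tau : nat -> nat -> {RV P >-> nat})
    (n : nat) : \bar R :=
  P [set w | outage C (deadlines (fun m => Q m w) (fun m i => tau m i w)) n].

(* Meaningful when outage_prob converges, since lim is a total operator. *)
Definition steady_outage_prob d (T : measurableType d) (R : realType)
    (P : probability T R) (C : nat)
    (Q : nat -> {RV P >-> nat}) (tau : nat -> nat -> {RV P >-> nat}) : \bar R :=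
  limn (outage_prob C Q tau).

(* Main.v *)
(* The number of unserved requests with deadline at most n obeys Lindley's
   recursion with service C, so an outage in slot n yields m < n such that more
   than (n - m) C requests with deadline at most n arrive after slot m, all of
   them in slots m+1, ..., n - Tmin.  With k = n - Tmin - m, Chernoff's bound
   at C / lambda and a sum over k >= 1 give
   P(outage) <= 2 (e C^(gamma - 1))^((1 + Tmin) C).  Conversely,
   (1 + Tmin) C + 1 arrivals with lookahead time Tmin in slot n - Tmin force an
   outage in slot n.  The two bounds have the same exponent.  The limit exists
   because dropping the arrivals of the first slot can only remove outages, so
   that by stationarity the outage probability increases with n. *)
From mathcomp Require Import zify ring lra.
Require Import Defs.

Local Open Scope classical_set_scope.
Local Open Scope ring_scope.


(** * Sample paths: an outage implies an overload, a burst implies an outage *)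

(** In a sorted list the elements of a downward closed [a] form a prefix, so dropping C entries
    removes as many of them as possible. *)
Lemma count_drop_sorted (a : pred nat) (C : nat) (s : seq nat) :
  (forall x y, (x <= y)%N -> a y -> a x) -> sorted leq s ->
  count a (drop C s) = (count a s - C)%N.
Proof.
move=> a_down; elim: s C => [|x s IH] [|C] //=; rewrite ?subn0 // => xs.
rewrite IH; last exact: path_sorted xs.
have [ax|/negP ax] := boolP (a x); first by rewrite subSS.
suff -> : count a s = 0%N by [].
apply/eqP; rewrite -leqn0 leqNgt -has_count -all_predC.
move: xs; rewrite (path_sortedE leq_trans) => /andP[/allP xs _].
by apply/allP => y /xs xy /=; apply/negP => /(a_down _ _ xy).
Qed.

Lemma leq_count_drop (a : pred nat) (C : nat) (s : seq nat) :
  (count a s <= count a (drop C s) + C)%N.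
Proof.
rewrite -{1}(cat_take_drop C s) count_cat addnC leq_add2l.
by rewrite (leq_trans (count_size _ _))// size_take_min geq_minl.
Qed.

(** Under EDF, requests with deadline beyond n never take service from those with deadline at most
    n, which thus form a queue of their own. Expiry before n can only shrink it, hence an
    inequality. *)
Lemma backlog_lindley (C : nat) (arr : nat -> seq nat) (n j : nat) :
  (count (leq^~ n) (edf_unserved C arr j.+1) <=
   count (leq^~ n) (edf_unserved C arr j) + count (leq^~ n) (arr j.+1) - C)%N.
Proof.
rewrite /= count_drop_sorted; last 2 first.
- by move=> x y; exact: leq_trans.
- exact: (sort_sorted leq_total).
rewrite count_sort count_cat leq_sub2r// leq_add2r count_filter.
by rewrite sub_count// => x /andP[].
Qed.

(* m is the last slot before n that leaves no request with deadline at most n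
   unserved. *)
Lemma outage_overload (C : nat) (arr : nat -> seq nat) (n : nat) :
  outage C arr n ->
  exists2 m, (m < n)%N &
    ((n - m) * C < \sum_(m <= j < n) count (leq^~ n) (arr j.+1))%N.
Proof.
move=> out; pose u j := count (leq^~ n) (edf_unserved C arr j).
have H j : (0 < u j)%N -> exists2 m, (m < j)%N &
   ((j - m) * C + u j <= \sum_(m <= i < j) count (leq^~ n) (arr i.+1))%N.
  elim: j => [|j IH uj] //.
  have lin := backlog_lindley C arr n j; rewrite -/(u j) -/(u j.+1) in lin.
  (* As [u j.+1] is positive, the truncated subtraction is exact: slot j + 1 works at full
     capacity. *)
  have {}lin : (C + u j.+1 <= u j + count (leq^~ n) (arr j.+1))%N by lia.
  have [uj0|/IH [m mj IHm]] := posnP (u j).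
    exists j => //; rewrite big_nat1 subSnn mul1n.
    by rewrite uj0 in lin.
  exists m; first exact: leqW.
  rewrite big_nat_recr ?(ltnW mj)// subSn ?(ltnW mj)// mulSnr -addnA.
  apply: leq_trans (leq_add (leqnn _) lin) _.
  by rewrite addnA leq_add2r.
have un : (0 < u n)%N by rewrite -has_count; apply/hasP; exists n.
have [m mn le] := H n un; exists m => //.
by apply: leq_trans le; rewrite -addn1 leq_add2l.
Qed.

(** Slots m + 1 to m + 1 + t serve at most (t + 1) C requests altogether, and no request with
    deadline m + 1 + t expires before the last of them. *)
Lemma burst_outage (C : nat) (arr : nat -> seq nat) (m t : nat) :
  (t.+1 * C < count_mem (m.+1 + t)%N (arr m.+1))%N ->
  outage C arr (m.+1 + t)%N.
Proof.
move=> burst; rewrite /outage -has_pred1 has_count.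
suff H j : (j <= t)%N -> (count_mem (m.+1 + t)%N (arr m.+1) <=
    count_mem (m.+1 + t)%N (edf_unserved C arr (m.+1 + j)) + j.+1 * C)%N.
  have := leq_trans burst (H t (leqnn _)).
  by rewrite -{1}[(t.+1 * C)%N]add0n ltn_add2r.
elim: j => [|j IH jt].
  rewrite mul1n addn0 /= (leq_trans _ (leq_count_drop _ _ _))//.
  by rewrite count_sort count_cat leq_addl.
apply: (leq_trans (IH (ltnW jt))).
rewrite (mulSn j.+1) addnA leq_add2r addnS [edf_unserved _ _ _.+1]/=.
rewrite (leq_trans _ (leq_count_drop _ _ _))// count_sort count_cat count_filter.
rewrite (leq_trans _ (leq_addr _ _))// sub_count// => x /= /eqP ->.
by rewrite eqxx /=; lia.
Qed.

(** * Monotonicity of EDF and time shift *)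

Lemma eq_edf_unserved (C : nat) (arr arr' : nat -> seq nat) (n : nat) :
  (forall j, (j < n)%N -> arr j.+1 = arr' j.+1) ->
  edf_unserved C arr n = edf_unserved C arr' n.
Proof.
elim: n => [//|n IH] eq_arr /=.
by rewrite IH ?eq_arr// => j jn; rewrite eq_arr// ltnW.
Qed.

(* EDF service is monotone for inclusion of multisets: the number of unserved
   requests with deadline x is c(<= x) - C minus c(< x) - C, truncated, where c
   counts the requests present, and this increases with c(< x) and c(= x). *)
Lemma count_drop_sort_le (C : nat) (s s' : seq nat) :
  (forall a, count a s <= count a s')%N ->
  forall a, (count a (drop C (sort leq s)) <= count a (drop C (sort leq s')))%N.
Proof.
move=> ss'.
suff mem_le x : (count_mem x (drop C (sort leq s)) <=
                 count_mem x (drop C (sort leq s')))%N.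
  (* Smaller multiplicities mean that the first list is a permutation of a subsequence of the
     second, which compares the counts of every predicate. *)
  have [t st /permP pt] := (count_subseqP _ _).1 mem_le.
  by move=> a; rewrite pt leq_count_subseq.
have count_memE (t : seq nat) : count_mem x t =
    (count (leq^~ x) t - count (ltn^~ x) t)%N.
  elim: t => //= y t ->.
  have : (count (ltn^~ x) t <= count (leq^~ x) t)%N.
    by apply: sub_count => z; exact: ltnW.
  by case: (ltngtP y x) => /=; lia.
rewrite !count_memE !count_drop_sorted ?(sort_sorted leq_total)//.
- rewrite !count_sort.
  have lt_le t : (count (ltn^~ x) t <= count (leq^~ x) t)%N.
    by apply: sub_count => z; exact: ltnW.
  have := ss' (pred1 x); rewrite !count_memE.
  move: (lt_le s) (lt_le s') (ss' (ltn^~ x)) (ss' (leq^~ x)).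
  move: (count (ltn^~ x) s) (count (ltn^~ x) s').
  by move: (count (leq^~ x) s) (count (leq^~ x) s'); lia.
all: try by move=> y z yz zx; exact: leq_trans zx.
all: by move=> y z yz zx; exact: leq_ltn_trans zx.
Qed.

Lemma deadlinesS (q : nat -> nat) (t : nat -> nat -> nat) (n : nat) :
  deadlines q t n.+1 = map succn (deadlines (q \o succn) (t \o succn) n).
Proof. by rewrite /deadlines -map_comp; apply: eq_map => i /=; rewrite addSn. Qed.

(** Up to relabelling slots by [succn], the premise concerns the same system without its first
    arrivals. Its backlog starts empty, and [count_drop_sort_le] keeps it included in the full
    backlog slot after slot. *)
Lemma outage_shift (C : nat) (q : nat -> nat) (t : nat -> nat -> nat) (n : nat) :
  outage C (deadlines (q \o succn) (t \o succn)) n ->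
  outage C (deadlines q t) n.+1.
Proof.
rewrite /outage -(mem_map succn_inj) -!has_pred1 !has_count => out.
(* The induction needs inclusion of multisets, hence all predicates instead of a single deadline. *)
apply: leq_trans out _; move: (pred1 _).
elim: n => [a|n IH a]; first by [].
have drop_sort_map X : map succn (drop C (sort leq X)) =
    drop C (sort leq (map succn X)) by rewrite map_drop sort_map.
rewrite drop_sort_map.
apply: count_drop_sort_le => b.
rewrite map_cat !count_cat (deadlinesS q t n.+1) leq_add2r.
have -> : map succn [seq x <- edf_unserved C (deadlines (q \o succn) (t \o succn)) n
    | (n < x)%N] = [seq x <- map succn
      (edf_unserved C (deadlines (q \o succn) (t \o succn)) n) | (n.+1 < x)%N].
  by rewrite filter_map.
by rewrite !count_filter.
Qed.



(** * Events defined through maps into countable types *)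

(** Indexing the fibres by the codes of [pickle_inv] gives a sequence of sets, as countable
    additivity requires. *)
Lemma preimage_bigcup_pickle (T : Type) (S : countType) (f : T -> S)
    (A : set S) :
  f @^-1` A = \bigcup_k (if @pickle_inv S k is Some s then
                           if `[< A s >] then f @^-1` [set s] else set0
                         else set0).
Proof.
apply/seteqP; split => w /=.
  move=> Afw; exists (pickle (f w)) => //.
  by rewrite pickleK_inv (asboolT Afw).
move=> [k _]; case: (@pickle_inv S k) => // s.
by case: asboolP => // As ->.
Qed.

Lemma measurable_countable_preimage (dT : measure_display)
    (T : measurableType dT) (S : countType) (f : T -> S) (A : set S) :
  (forall s, measurable (f @^-1` [set s])) -> measurable (f @^-1` A).
Proof.
move=> mf; rewrite preimage_bigcup_pickle; apply: bigcupT_measurable => k.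
case: (@pickle_inv S k) => [s|]; last exact: measurable0.
by case: asboolP => _; [exact: mf|exact: measurable0].
Qed.

Lemma measure_preimage_ext (dT : measure_display) (T : measurableType dT)
    (R : realType) (mu : {measure set T -> \bar R}) (S : countType)
    (f g : T -> S) (A : set S) :
  (forall s, measurable (f @^-1` [set s])) ->
  (forall s, measurable (g @^-1` [set s])) ->
  (forall s, mu (f @^-1` [set s]) = mu (g @^-1` [set s])) ->
  mu (f @^-1` A) = mu (g @^-1` A).
Proof.
move=> mf mg fg; rewrite !preimage_bigcup_pickle.
have trivI (h : T -> S) : trivIset [set: nat] (fun k =>
    if @pickle_inv S k is Some s then
      if `[< A s >] then h @^-1` [set s] else set0 else set0).
  move=> i j _ _ [w []].
  case Ei: (@pickle_inv S i) => [s|//]; case Ej: (@pickle_inv S j) => [t|//].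
  case: ifP => // _ /= hs; case: ifP => // _ /= ht.
  have := @pickle_invK S i; have := @pickle_invK S j.
  by rewrite Ei Ej /= -hs -ht => <- <-.
have meas (h : T -> S) k : (forall s, measurable (h @^-1` [set s])) ->
    measurable (if @pickle_inv S k is Some s then
      if `[< A s >] then h @^-1` [set s] else set0 else set0).
  move=> mh; case: (@pickle_inv S k) => [s|]; last exact: measurable0.
  by case: ifP => _; [exact: mh|exact: measurable0].
rewrite !measure_semi_bigcup //; [|by move=> k; exact: meas|
  by apply: bigcupT_measurable => k; exact: meas|by move=> k; exact: meas|
  by apply: bigcupT_measurable => k; exact: meas].
apply: eq_eseriesr => k _; case: (@pickle_inv S k) => [s|//].
by case: ifP.
Qed.

Lemma measurable_map_preimage (dT : measure_display) (T : measurableType dT)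
    (I : Type) (S : eqType) (F : I -> T -> S) (r : seq I) (s : seq S) :
  (forall i x, measurable (F i @^-1` [set x])) ->
  measurable ((fun w => [seq F i w | i <- r]) @^-1` [set s]).
Proof.
move=> mF; elim: r s => [|i r IH] [|x s].
- by rewrite preimage_cst mem_set//; exact: measurableT.
- by rewrite preimage_cst memNset//; exact: measurable0.
- rewrite (_ : _ @^-1` _ = set0); first exact: measurable0.
  by rewrite -subset0 => w.
- rewrite (_ : _ @^-1` _ = F i @^-1` [set x] `&`
    (fun w => [seq F i w | i <- r]) @^-1` [set s]); first exact: measurableI.
  by apply/seteqP; split => w /= [-> ->].
Qed.

(** * Finite request data: measurability, law and stationarity *)

(** All that an outage in slot n depends on, as an element of a countable type; the numbers of
    arrivals are recorded as the lengths of the inner lists. *)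
Definition lookaheads (n : nat) (q : nat -> nat) (t : nat -> nat -> nat) :
    seq (seq nat) :=
  [seq [seq t j.+1 i | i <- iota 0 (q j.+1)] | j <- iota 0 n].

(** The list begins with slot 1, so slot j reads entry j - 1. *)
Definition lookahead_outage (C n : nat) (l : seq (seq nat)) : bool :=
  outage C (fun j => [seq (j + k)%N | k <- nth [::] l j.-1]) n.

Lemma outageE (C n : nat) (q : nat -> nat) (t : nat -> nat -> nat) :
  outage C (deadlines q t) n = lookahead_outage C n (lookaheads n q t).
Proof.
rewrite /lookahead_outage /outage.
congr (_ \in _); apply: eq_edf_unserved => j jn /=.
by rewrite (nth_map 0%N) ?size_iota// nth_iota// add0n -map_comp.
Qed.

Lemma measurable_lookaheads (dT : measure_display) (T : measurableType dT)
    (R : realType) (P : probability T R) (Q : nat -> {RV P >-> nat})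
    (tau : nat -> nat -> {RV P >-> nat}) (n : nat) (l : seq (seq nat)) :
  measurable ((fun w => lookaheads n (Q^~ w) (fun m i => tau m i w))
                @^-1` [set l]).
Proof.
apply: (@measurable_map_preimage _ _ _ _
  (fun j w => [seq tau j.+1 i w | i <- iota 0 (Q j.+1 w)])) => j x.
(* The list has random length; once this length is fixed to [size x], the index range is
   deterministic. *)
rewrite (_ : _ @^-1` _ = Q j.+1 @^-1` [set size x] `&`
    (fun w => [seq tau j.+1 i w | i <- iota 0 (size x)]) @^-1` [set x]).
  apply: measurableI; first exact: measurable_funPTI.
  by apply: measurable_map_preimage => i k; exact: measurable_funPTI.
apply/seteqP; split => w /=.
  by move=> <-; rewrite size_map size_iota.
by move=> [->].
Qed.

Lemma measurable_outage (dT : measure_display) (T : measurableType dT)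
    (R : realType) (P : probability T R) (Q : nat -> {RV P >-> nat})
    (tau : nat -> nat -> {RV P >-> nat}) (C n : nat) :
  measurable [set w | outage C (deadlines (Q^~ w) (fun m i => tau m i w)) n].
Proof.
under eq_fun do rewrite outageE.
apply: (@measurable_countable_preimage _ _ _
  (fun w => lookaheads n (Q^~ w) (fun m i => tau m i w))
  [set l | lookahead_outage C n l]).
exact: measurable_lookaheads.
Qed.


(* The variables that determine [lookaheads n] when its value is l; the list has
   no duplicates anyway, undup makes this immediate. *)
Definition slot_variables (n : nat) (l : seq (seq nat)) : seq (nat + nat * nat) :=
  undup (flatten [seq inl j :: [seq inr (j, i) | i <- iota 0 (size (nth [::] l j))]
                 | j <- iota 0 n]).

Definition slot_value (l : seq (seq nat)) (z : nat + nat * nat) : nat :=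
  match z with
  | inl j => size (nth [::] l j)
  | inr (j, i) => nth 0%N (nth [::] l j) i
  end.

(** Turns a value of the data into finitely many constraints on single variables, the form of event
    that [mutually_independent] handles. *)
Lemma lookaheads_eqP (n : nat) (q : nat -> nat) (t : nat -> nat -> nat)
    (l : seq (seq nat)) : size l = n ->
  lookaheads n q t = l <->
  forall z, z \in slot_variables n l ->
    match z with inl j => q j.+1 | inr (j, i) => t j.+1 i end = slot_value l z.
Proof.
move=> ln; split.
  move=> <- z; rewrite mem_undup => /flattenP[/= r /mapP[j]].
  rewrite mem_iota add0n => jn -> {r}.
  have nthj : nth [::] (lookaheads n q t) j = [seq t j.+1 i | i <- iota 0 (q j.+1)].
    by rewrite (nth_map 0%N) ?size_iota// nth_iota.
  rewrite nthj size_map size_iota inE => /orP[/eqP ->|/mapP[i]].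
    by rewrite /= nthj size_map size_iota.
  rewrite mem_iota add0n => ij ->.
  by rewrite /= nthj (nth_map 0%N) ?size_iota// nth_iota.
move=> H; apply: (@eq_from_nth _ [::]); first by rewrite size_map size_iota ln.
rewrite size_map size_iota => j jn.
rewrite (nth_map 0%N) ?size_iota// nth_iota// add0n.
have slot z : z \in inl j :: [seq inr (j, i) | i <- iota 0 (size (nth [::] l j))] ->
    z \in slot_variables n l.
  move=> zj; rewrite mem_undup; apply/flattenP; eexists; last exact: zj.
  by apply/mapP; exists j; rewrite // mem_iota.
have qj : q j.+1 = size (nth [::] l j) by apply: (H (inl j)); exact/slot/mem_head.
apply: (@eq_from_nth _ 0%N); first by rewrite size_map size_iota.
rewrite size_map size_iota => i ij.
rewrite (nth_map 0%N) ?size_iota// nth_iota// add0n.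
apply: (H (inr (j, i))); apply: slot.
by rewrite inE; apply/orP; right; apply/mapP; exists i; rewrite // mem_iota -qj.
Qed.

(** The right-hand side is free of [a]: this is the stationarity of the requests. *)
Lemma lookaheads_law (dT : measure_display) (T : measurableType dT)
    (R : realType) (P : probability T R) (lambda : R) (pmf : nat -> R)
    (Q : nat -> {RV P >-> nat}) (tau : nat -> nat -> {RV P >-> nat})
    (a n : nat) (l : seq (seq nat)) :
  iid_poisson_requests lambda pmf Q tau ->
  P ((fun w => lookaheads n (fun m => Q (a + m)%N w)
                 (fun m i => tau (a + m)%N i w)) @^-1` [set l]) =
  (if size l == n then
     \prod_(z <- slot_variables n l)
       (if z is inl _ then poisson_pmf lambda else pmf) (slot_value l z)
   else 0)%:E.
Proof.
move=> [Qlaw taulaw indep].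
case: eqP => [ln|nln]; last first.
  rewrite (_ : _ @^-1` _ = set0) ?measure0// -subset0 => w /= lw.
  by apply: nln; rewrite -lw size_map size_iota.
pose sh (z : nat + nat * nat) : nat + nat * nat :=
  match z with inl j => inl (a + j)%N | inr (j, i) => inr ((a + j)%N, i) end.
(* A left inverse of [sh], so that the prescribed values can be given as a function of the shifted
   index. *)
pose unsh (z : nat + nat * nat) : nat + nat * nat :=
  match z with inl j => inl (j - a)%N | inr (j, i) => inr ((j - a)%N, i) end.
have shK : cancel sh unsh by move=> [j|[j i]]; rewrite /= addKn.
have := indep (map sh (slot_variables n l)) (fun z => [set slot_value l (unsh z)]).
rewrite (map_inj_uniq (can_inj shK)) undup_uniq => /(_ erefl (fun=> I)).
rewrite big_map.
under eq_bigr do rewrite shK.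
set S := \bigcap_(_ in _) _; set S' := _ @^-1` _ => PS.
have -> : S' = S.
  apply/seteqP; split => w; rewrite /S' /S /=.
    move=> /(lookaheads_eqP _ _ _ _ ln) H _ /= /mapP[z zin ->].
    by rewrite shK; have := H _ zin; case: (z) => [j|[j i]] /=; rewrite addnS.
  move=> H; apply/lookaheads_eqP => // z zin.
  have := H (sh z) (map_f _ zin); rewrite shK.
  by case: (z) => [j|[j i]] /=; rewrite addnS.
rewrite PS -prodEFin; apply: eq_bigr => -[j|[j i]] _ /=; first exact: Qlaw.
exact: taulaw.
Qed.

Lemma outage_prob_nondecreasing (dT : measure_display) (T : measurableType dT)
    (R : realType) (P : probability T R) (lambda : R) (pmf : nat -> R)
    (Q : nat -> {RV P >-> nat}) (tau : nat -> nat -> {RV P >-> nat}) (C : nat) :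
  iid_poisson_requests lambda pmf Q tau ->
  {homo outage_prob C Q tau : m n / (m <= n)%N >-> (m <= n)%E}.
Proof.
move=> req; apply: homo_leq => [//|x y z|n]; first exact: le_trans.
pose f a w := lookaheads n (fun m => Q (a + m)%N w) (fun m i => tau (a + m)%N i w).
have mf a s : measurable (f a @^-1` [set s]).
  exact: (measurable_lookaheads _ _ _ _ (fun m => Q (a + m)%N)
    (fun m => tau (a + m)%N)).
have shift : P (f 0%N @^-1` [set l | lookahead_outage C n l]) =
             P (f 1%N @^-1` [set l | lookahead_outage C n l]).
  apply: measure_preimage_ext => // s.
  transitivity (P (f 0%N @^-1` [set s])); first by [].
  transitivity (P (f 1%N @^-1` [set s])); last by [].
  by rewrite /f !(lookaheads_law _ _ _ _ _ _ _ _ _ _ _ req).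
have -> : outage_prob C Q tau n =
          P (f 0%N @^-1` [set l | lookahead_outage C n l]).
  by congr (P _); apply/seteqP; split => w /=; rewrite outageE.
rewrite shift; apply: le_measure; rewrite ?inE.
- exact: measurable_countable_preimage.
- exact: measurable_outage.
- by move=> w /=; rewrite -outageE; exact: outage_shift.
Qed.


(** * Chernoff bound for Poisson arrivals *)

Lemma poisson_generating (R : realType) (lambda z : R) :
  0 < lambda -> 0 <= z ->
  (\sum_(0 <= j <oo) (poisson_pmf lambda j * z ^+ j)%:E)%E =
  (expR (lambda * (z - 1)))%:E.
Proof.
move=> l0 z0.
have -> : expR (lambda * (z - 1)) = expR (- lambda) * expR (lambda * z).
  by rewrite -expRD; congr expR; ring.
rewrite EFinM.
have -> : (expR (lambda * z))%:E =
    (\sum_(0 <= j <oo) (exp_coeff (lambda * z) j)%:E)%E.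
  rewrite /expR -EFin_lim; last exact: is_cvg_series_exp_coeff.
  by congr (limn _); apply/funext => n /=; rewrite sumEFin.
rewrite -nneseriesZl; last first.
  by move=> j _; rewrite lee_fin exp_coeff_ge0// mulr_ge0// ltW.
apply: eq_eseriesr => j _; rewrite /poisson_pmf l0 exp_coeffE /= -EFinM.
by rewrite exprMn; congr EFin; ring.
Qed.

(** When j exceeds K the truncated difference makes the left side 1, and the right side is z to the
    power j - K, at least 1. *)
Lemma exprV_subn_le (R : realType) (z : R) (K j : nat) :
  1 <= z -> z^-1 ^+ (K - j) <= z^-1 ^+ K * z ^+ j.
Proof.
move=> z1; have z0 : 0 < z by exact: lt_le_trans z1.
rewrite exprVn exprVn ler_pdivlMl ?exprn_gt0// ler_pdivrMr ?exprn_gt0//.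
by rewrite -exprD ler_weXn2l//; lia.
Qed.

(* The prefix s is there for the induction on k: conditioning on one more value
   of X only uses the joint law, so independence of sums is never needed. *)
Lemma chernoff_prefix (dT : measure_display) (T : measurableType dT)
    (R : realType) (P : probability T R) (pmf : nat -> R) (z E : R)
    (X : nat -> {RV P >-> nat}) (k K : nat) (s : seq nat) :
  (forall j, 0 <= pmf j) -> 1 <= z ->
  (\sum_(0 <= j <oo) (pmf j * z ^+ j)%:E = E%:E)%E ->
  (forall s, P [set w | [seq X i w | i <- iota 0 (size s)] = s] =
     (\prod_(x <- s) pmf x)%:E) ->
  (P [set w | [seq X i w | i <- iota 0 (size s)] = s /\
      (K <= sumn [seq X i w | i <- iota (size s) k])%N] <=
   ((\prod_(x <- s) pmf x) * (z^-1 ^+ K * E ^+ k))%:E)%E.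
Proof.
move=> pmf0 z1 sumE law; have z0 : 0 < z by exact: lt_le_trans z1.
have E0 : 0 <= E.
  rewrite -lee_fin -sumE; apply: nneseries_ge0 => j _ _.
  by rewrite lee_fin mulr_ge0// exprn_ge0// ltW.
have meas (B : set (seq nat)) m : measurable [set w | B [seq X i w | i <- iota 0 m]].
  apply: (@measurable_countable_preimage _ _ _ (fun w => [seq X i w | i <- iota 0 m])).
  by move=> t; apply: measurable_map_preimage => i x; exact: measurable_funPTI.
have mev k' K' (t : seq nat) : measurable
    [set w | [seq X i w | i <- iota 0 (size t)] = t /\
      (K' <= sumn [seq X i w | i <- iota (size t) k'])%N].
  rewrite (_ : [set _ | _] = [set w | [set u | take (size t) u = t /\
    (K' <= sumn (drop (size t) u))%N] [seq X i w | i <- iota 0 (size t + k')]]).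
    exact: meas.
  by apply/seteqP; split => w /=; rewrite -map_take -map_drop take_iota drop_iota
    (minn_idPl (leq_addr _ _)) add0n addKn.
elim: k K s => [|k IH] K s.
  rewrite expr0 mulr1; have [->|K0] := posnP K.
    rewrite expr0 mulr1 -law; apply: le_measure; rewrite ?inE.
    - exact: (mev 0%N 0%N s).
    - exact: (meas [set t | t = s]).
    - by move=> w [].
  rewrite (_ : [set _ | _] = set0) ?measure0; last first.
    by rewrite -subset0 => w [_] /=; rewrite leqNgt K0.
  by rewrite lee_fin mulr_ge0 ?exprn_ge0 ?invr_ge0 ?(ltW z0)// prodr_ge0.
(* Union bound over the value j of the next variable; the last k values must then reach K - j,
   truncated at 0. *)
apply: (@le_trans _ _ (\sum_(0 <= j <oo)
    P [set w | [seq X i w | i <- iota 0 (size (rcons s j))] = rcons s j /\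
      (K - j <= sumn [seq X i w | i <- iota (size (rcons s j)) k])%N])%E).
  apply: measure_sigma_subadditive; [by move=> j; exact: mev|exact: mev|].
  move=> w [ws /= Kw]; exists (X (size s) w) => //=.
  rewrite size_rcons -addn1 iotaD map_cat ws add0n cats1 addn1; split => //.
  by rewrite leq_subLR.
(* Summing over j turns the last factor into one more power of E. *)
apply: (@le_trans _ _ (\sum_(0 <= j <oo) (((\prod_(x <- s) pmf x) *
    (z^-1 ^+ K * E ^+ k))%:E * (pmf j * z ^+ j)%:E))%E); last first.
  rewrite nneseriesZl; last by move=> j _; rewrite lee_fin mulr_ge0// exprn_ge0// ltW.
  by rewrite sumE -EFinM -!mulrA -exprSr.
apply: lee_nneseries => [j _ _|j _]; first exact: measure_ge0.
apply: (le_trans (IH _ _)); rewrite big_rcons/= -EFinM lee_fin.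
rewrite [leRHS](_ : _ = (\prod_(x <- s) pmf x) * pmf j *
  ((z^-1 ^+ K * z ^+ j) * E ^+ k)); last by ring.
rewrite [X in X * _](_ : _ = (\prod_(x <- s) pmf x) * pmf j).
  rewrite ler_wpM2l ?mulr_ge0 ?prodr_ge0// ler_wpM2r ?exprn_ge0//.
  exact: exprV_subn_le.
by ring.
Qed.


Lemma arrivals_law (dT : measure_display) (T : measurableType dT)
    (R : realType) (P : probability T R) (lambda : R) (pmf : nat -> R)
    (Q : nat -> {RV P >-> nat}) (tau : nat -> nat -> {RV P >-> nat})
    (a : nat) (s : seq nat) :
  iid_poisson_requests lambda pmf Q tau ->
  P [set w | [seq Q (a + i).+1 w | i <- iota 0 (size s)] = s] =
  (\prod_(x <- s) poisson_pmf lambda x)%:E.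
Proof.
move=> [Qlaw _ indep].
have inj : injective (fun i => inl (a + i)%N : nat + nat * nat).
  by move=> i j [/addnI].
have /= := indep [seq inl (a + i)%N | i <- iota 0 (size s)]
  (fun z => [set if z is inl j then nth 0%N s (j - a) else 0%N]).
rewrite (map_inj_uniq inj) iota_uniq => /(_ erefl (fun=> I)).
rewrite big_map.
under eq_bigr do rewrite addKn Qlaw.
rewrite prodEFin => PS; rewrite [in RHS](big_nth 0%N) /index_iota subn0 -PS.
congr (P _); apply/seteqP; split => w /=.
  move=> ws z /= /mapP[i]; rewrite mem_iota add0n => /= i_s ->.
  by rewrite addKn /= -[in RHS]ws (nth_map 0%N) ?size_iota// nth_iota.
move=> H; apply: (@eq_from_nth _ 0%N); rewrite size_map size_iota// => i i_s.
rewrite (nth_map 0%N) ?size_iota// nth_iota// add0n.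
rewrite (H (inl (a + i)%N)) ?addKn//.
by apply/mapP; exists i; rewrite // mem_iota.
Qed.

Lemma arrivals_tail (dT : measure_display) (T : measurableType dT)
    (R : realType) (P : probability T R) (lambda : R) (pmf : nat -> R)
    (Q : nat -> {RV P >-> nat}) (tau : nat -> nat -> {RV P >-> nat})
    (a k K : nat) (z : R) :
  iid_poisson_requests lambda pmf Q tau -> 0 < lambda -> 1 <= z ->
  (P [set w | (K <= sumn [seq Q (a + i).+1 w | i <- iota 0 k])%N] <=
   (z^-1 ^+ K * expR (lambda * (z - 1)) ^+ k)%:E)%E.
Proof.
move=> req l0 z1; have z0 : 0 < z by exact: lt_le_trans z1.
have := chernoff_prefix _ _ _ P (poisson_pmf lambda) z _ (fun i => Q (a + i).+1) k K
  [::] (poisson_pmf_ge0 _) z1 (poisson_generating _ _ _ l0 (ltW z0)).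
rewrite big_nil mul1r /= => H; apply: le_trans (H _); last first.
  by move=> s; exact: arrivals_law req.
rewrite le_eqVlt; apply/orP; left; apply/eqP; congr (P _).
by apply/seteqP; split => w /=; [move=> ?; split|case].
Qed.

(** * Upper bound on the outage probability *)

Lemma nneseries_geometric_le2 (R : realType) (r : R) : 0 <= r -> r <= 2^-1 ->
  (\sum_(0 <= j <oo) (r ^+ j)%:E <= 2%:E)%E.
Proof.
move=> r0 r2; have r1 : `|r| < 1 by rewrite ger0_norm//; lra.
have -> : (\sum_(0 <= j <oo) (r ^+ j)%:E = ((1 - r)^-1)%:E)%E.
  rewrite -[(1 - r)^-1]mul1r -(cvg_lim _ (cvg_geometric_series (a := 1) r1))//.
  rewrite -EFin_lim; last exact: is_cvg_geometric_series.
  congr (limn _); apply/funext => n /=; rewrite sumEFin; congr EFin.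
  by apply: eq_bigr => i _; rewrite /geometric /= mul1r.
by rewrite lee_fin invf_ple ?posrE//; lra.
Qed.

Lemma outage_prob_le (dT : measure_display) (T : measurableType dT)
    (R : realType) (P : probability T R) (lambda : R) (pmf : nat -> R)
    (Q : nat -> {RV P >-> nat}) (tau : nat -> nat -> {RV P >-> nat})
    (C Tmin n : nat) :
  iid_poisson_requests lambda pmf Q tau ->
  (forall k, (k < Tmin)%N -> pmf k = 0) -> (0 < C)%N -> 0 < lambda ->
  expR 1 * (lambda / C%:R) <= 2^-1 ->
  (outage_prob C Q tau n <=
   (2 * (expR 1 * (lambda / C%:R)) ^+ (Tmin.+1 * C))%:E)%E.
Proof.
move=> req pmf0 C0 l0 r2; set r := expR 1 * (lambda / C%:R).
have C0' : 0 < C%:R :> R by rewrite ltr0n.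
have r0 : 0 <= r by rewrite mulr_ge0 ?expR_ge0 ?divr_ge0// ltW.
(* Admissibility of the Chernoff parameter: lambda / C <= e lambda / C <= 1 / 2. *)
have lC : 1 <= C%:R / lambda.
  rewrite -invf_div invf_ge1 ?divr_gt0// -[leLHS]mul1r.
  rewrite (le_trans _ (le_trans r2 _)) ?invf_le1 ?ler1n//.
  rewrite ler_wpM2r ?divr_ge0 ?(ltW l0)//.
  by rewrite (le_trans _ (expR_ge1Dx _))// lerDl.
(* Lookahead times are at least Tmin only almost surely; N is the exceptional null set. *)
pose N := \bigcup_m \bigcup_i \bigcup_k
  (if (k < Tmin)%N then tau m.+1 i @^-1` [set k] else set0).
have mN' m i k : measurable
    (if (k < Tmin)%N then tau m.+1 i @^-1` [set k] else set0).
  by case: ifP => _; [exact: measurable_funPTI|exact: measurable0].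
have mN : measurable N by do 3 (apply: bigcupT_measurable => ?).
have PN : P N = 0%E.
  apply: measure_negligible => //; do 3 (apply: negligible_bigcup => ?).
  apply/negligibleP => //; case: ifP => [k_lt|_]; last exact: measure0.
  by case: req => _ taulaw _; apply: etrans (taulaw _ _ _) _; rewrite pmf0.
(* Here k = j + 1, and the window consists of slots n - Tmin - j to n - Tmin. For large j the
   truncated start gives slots 1 to j + 1; the tail bound holds for every window, so the union may
   run over all j. *)
pose G j := [set w | ((j.+1 + Tmin) * C <=
  sumn [seq Q ((n - Tmin - j.+1) + i).+1 w | i <- iota 0 j.+1])%N].
have mG j : measurable (G j).
  apply: (@measurable_countable_preimage _ _ _
    (fun w => [seq Q ((n - Tmin - j.+1) + i).+1 w | i <- iota 0 j.+1])
    [set s | ((j.+1 + Tmin) * C <= sumn s)%N]) => s.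
  by apply: measurable_map_preimage => i x; exact: measurable_funPTI.
(* Chernoff bound at z = C / lambda. *)
have PG j : (P (G j) <= (r ^+ (Tmin.+1 * C))%:E * ((r ^+ C) ^+ j)%:E)%E.
  apply: le_trans (arrivals_tail _ _ _ _ _ _ _ _ _ _ _ _ req l0 lC) _.
  rewrite -EFinM lee_fin -exprM -exprD mulrBr mulr1 mulrCA mulfV ?gt_eqF// mulr1.
  rewrite invf_div.
  have -> : (Tmin.+1 * C + C * j = (j.+1 + Tmin) * C)%N by nia.
  (* Chernoff gives exp((C - lambda) (j + 1)); enlarging it to exp((j + 1 + Tmin) C) makes the whole
     bound a power of r. *)
  rewrite /r [leRHS]exprMn [leLHS]mulrC ler_wpM2r ?exprn_ge0 ?divr_ge0 ?(ltW l0)//.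
  rewrite -!expRM_natl ler_expR mulr1 natrM.
  rewrite ler_pM// ?ler_nat ?leq_addr ?subr_ge0 ?gerBl ?(ltW l0)//.
  by rewrite -[leLHS]mul1r -ler_pdivlMr.
have sub : [set w | outage C (deadlines (Q^~ w) (fun m i => tau m i w)) n] `<=`
    N `|` \bigcup_j G j.
  move=> w /= out; have [Nw|Nw] := pselect (N w); [by left|right].
  have tau_ge m i : (Tmin <= tau m.+1 i w)%N.
    rewrite leqNgt; apply/negP => lt; apply: Nw; exists m => //; exists i => //.
    by exists (tau m.+1 i w) => //; rewrite lt.
  have cnt j : (count (leq^~ n) (deadlines (Q^~ w) (fun m i => tau m i w) j.+1)
     <= if (j.+1 + Tmin <= n)%N then Q j.+1 w else 0)%N.
    case: ifPn => [_|jn].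
      by rewrite (leq_trans (count_size _ _))// size_map size_iota.
    rewrite leqn0 -[_ == _]negbK -lt0n -has_count; apply/hasPn => k /mapP[i _ ->].
    by have := tau_ge j i; lia.
  have [m mn over] := outage_overload _ _ _ out.
  have {}over : ((n - m) * C <
      \sum_(m <= j < n) if (j.+1 + Tmin <= n)%N then Q j.+1 w else 0)%N.
    by apply: leq_trans over _; exact: leq_sum.
  (* Otherwise every summand of [over] vanishes, so the window would be empty. *)
  have mT : (m + Tmin < n)%N.
    rewrite ltnNge; apply/negP => nm; move: over.
    by rewrite big_nat_cond big1// => j; case: ifP => //; lia.
  exists (n - Tmin - m.+1)%N => //; rewrite /G.
  have -> : (n - Tmin - m.+1).+1 = (n - Tmin - m)%N by lia.
  have -> : (n - Tmin - (n - Tmin - m) = m)%N by lia.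
  have -> : (n - Tmin - m + Tmin = n - m)%N by lia.
  rewrite /=; apply: (leq_trans (ltnW over)).
  have nT : (n - Tmin <= n)%N by lia.
  rewrite (@big_cat_nat _ _ _ (n - Tmin)%N)/=; [|lia|lia].
  rewrite [X in (_ + X)%N]big_nat_cond [X in (_ + X)%N]big1 ?addn0; last first.
    by move=> j; case: ifP => //; lia.
  rewrite sumnE big_map -(big_map (addn m) xpredT (fun j => Q j.+1 w)) -iotaDl addn0.
  by apply: leq_sum => j _; case: ifP.
apply: (@le_trans _ _ (P (N `|` \bigcup_j G j))).
  apply: le_measure; rewrite ?inE//; first exact: measurable_outage.
  by apply: measurableU => //; exact: bigcupT_measurable.
apply: le_trans (measureU2 _ _ _) _ => //; first exact: bigcupT_measurable.
rewrite [X in (X + _)%E](_ : _ = 0%E)// add0e.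
apply: (@le_trans _ _ (\sum_(0 <= j <oo) P (G j))%E).
  by apply: measure_sigma_subadditive => //; exact: bigcupT_measurable.
apply: (@le_trans _ _ (\sum_(0 <= j <oo)
  ((r ^+ (Tmin.+1 * C))%:E * ((r ^+ C) ^+ j)%:E))%E).
  by apply: lee_nneseries => [j _ _|j _]; [exact: measure_ge0|exact: PG].
rewrite nneseriesZl; last by move=> j _; rewrite lee_fin !exprn_ge0.
rewrite muleC EFinM lee_wpmul2r ?lee_fin ?exprn_ge0//.
apply: nneseries_geometric_le2; first exact: exprn_ge0.
rewrite (le_trans _ r2)// -[leRHS]expr1 ler_wiXn2l//.
by rewrite (le_trans r2)// invf_le1 ?ler1n.
Qed.


(** * Lower bound on the outage probability *)

Lemma outage_prob_ge (dT : measure_display) (T : measurableType dT)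
    (R : realType) (P : probability T R) (lambda : R) (pmf : nat -> R)
    (Q : nat -> {RV P >-> nat}) (tau : nat -> nat -> {RV P >-> nat})
    (C Tmin n : nat) :
  iid_poisson_requests lambda pmf Q tau -> (Tmin < n)%N ->
  ((poisson_pmf lambda (Tmin.+1 * C).+1 * pmf Tmin ^+ (Tmin.+1 * C).+1)%:E <=
   outage_prob C Q tau n)%E.
Proof.
move=> [Qlaw taulaw indep] Tn; set K := (Tmin.+1 * C).+1.
have [m ->] : exists m, n = (m.+1 + Tmin)%N by exists (n - Tmin).-1; lia.
(* The burst prescribes finitely many variables, the number of arrivals in slot m + 1 and all their
   lookahead times, so its probability is an exact product. *)
pose burst : seq (nat + nat * nat) := inl m :: [seq inr (m, i) | i <- iota 0 K].
have burst_uniq : uniq burst.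
  rewrite cons_uniq map_inj_uniq ?iota_uniq ?andbT; last by move=> i j [].
  by apply/mapP => -[].
have := indep burst (fun z => [set if z is inl _ then K else Tmin]) burst_uniq
  (fun=> I).
rewrite big_cons big_map Qlaw.
under eq_bigr do rewrite taulaw.
rewrite prodEFin -EFinM big_const_seq count_predT size_iota iter_mulr_1 => <-.
apply: le_measure; rewrite ?inE.
- apply: fin_bigcap_measurable; first exact: finite_seq.
  by move=> [j|[j i]] _; exact: measurable_funPTI.
- exact: measurable_outage.
move=> w H /=; apply: burst_outage.
have Qm : Q m.+1 w = K by apply: (H (inl m)); exact: mem_head.
rewrite /deadlines Qm count_map.
rewrite (_ : count _ _ = K)//.
rewrite -[RHS](size_iota 0); apply/eqP; rewrite -all_count.
apply/allP => i iK /=; rewrite (_ : tau m.+1 i w = Tmin)//.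
apply: (H (inr (m, i))); rewrite /= inE; apply/orP; right.
by apply/mapP; exists i.
Qed.

(** * Logarithms of the two bounds *)

(** Coarser than Stirling, but the logarithm loses only O(n), negligible against C ln C for n of
    order C. *)
Lemma fact_leq_expn (n : nat) : (n`! <= n ^ n)%N.
Proof.
elim: n => // n IH; rewrite factS expnS leq_mul2l /=.
by rewrite (leq_trans IH)//; case: n {IH} => // n; rewrite leq_exp2r.
Qed.

(** The first factor is K / C. Per arrival, [K! <= K ^ K] and K <= (Tmin + 2) C cost ln C + ln (Tmin
    + 2), while lambda gains gamma ln C. The factor exp(- lambda) costs lambda <= C, hence the last
    term. *)
Lemma ln_poisson_burst (R : realType) (gamma p : R) (C Tmin K : nat) :
  0 <= gamma -> gamma <= 1 -> 0 < p -> (1 < C)%N ->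
  K = (Tmin.+1 * C).+1 ->
  - ln (poisson_pmf (C%:R `^ gamma) K * p ^+ K) / (C%:R * ln C%:R) <=
  (Tmin.+1%:R + C%:R^-1) *
    ((1 - gamma) + (ln Tmin.+2%:R - ln p) / ln C%:R) + (ln C%:R)^-1.
Proof.
move=> g0 g1 p0 C1 KC.
have Cgt0 : (0 < C)%N by exact: ltnW.
have C0 : 0 < C%:R :> R by rewrite ltr0n.
have L0 : 0 < ln C%:R :> R by rewrite ln_gt0// ltr1n.
have lam0 : 0 < C%:R `^ gamma by exact: powR_gt0.
have lamC : C%:R `^ gamma <= C%:R.
  by rewrite -[leRHS]powRr1 ?ler_powR// ?ler1n ?(ltW C0).
have K0 : 0 < K%:R :> R by rewrite ltr0n KC.
have KE : K%:R = (Tmin.+1%:R + C%:R^-1) * C%:R :> R.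
  by rewrite mulrDl mulVf ?gt_eqF// KC -addn1 natrD natrM.
have lnfact : ln K`!%:R <= K%:R * (ln Tmin.+2%:R + ln C%:R) :> R.
  rewrite (le_trans (y := ln (K%:R ^+ K)))//.
    rewrite ler_ln ?posrE ?exprn_gt0 ?(ltr0n _ K`!) ?fact_gt0//.
    by rewrite -natrX ler_nat fact_leq_expn.
  rewrite lnXn// mulr_natl lerMn2r /= -lnM ?posrE ?ltr0n//.
  rewrite ler_ln ?posrE// ?mulr_gt0// ?ltr0n// -natrM ler_nat KC.
  by rewrite (mulSn Tmin.+1) -add1n leq_add2r.
rewrite /poisson_pmf lam0.
rewrite !lnM ?posrE ?mulr_gt0 ?invr_gt0 ?exprn_gt0 ?expR_gt0 ?ltr0n ?fact_gt0//.
rewrite lnV ?posrE ?ltr0n ?fact_gt0// expRK !lnXn// ln_powR.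
rewrite ler_pdivrMr ?mulr_gt0//.
rewrite [leRHS](_ : _ = K%:R *
  ((1 - gamma) * ln C%:R + (ln Tmin.+2%:R - ln p)) + C%:R); last first.
  by rewrite KE; field; rewrite !gt_eqF.
rewrite -(mulr_natl (ln p)) -(mulr_natl (gamma * _)).
by lra.
Qed.


(** The powers of e and the constant 2 of the upper bound leave the two corrections, which vanish as
    C grows. *)
Lemma ln_outage_bound (R : realType) (gamma : R) (C Tmin : nat) :
  (1 < C)%N ->
  - ln (2 * (expR 1 * (C%:R `^ gamma / C%:R)) ^+ (Tmin.+1 * C)) /
     (C%:R * ln C%:R) =
  Tmin.+1%:R * ((1 - gamma) - (ln C%:R)^-1) - ln 2 * C%:R^-1 * (ln C%:R)^-1.
Proof.
move=> C1; have Cgt0 : (0 < C)%N by exact: ltnW.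
have C0 : 0 < C%:R :> R by rewrite ltr0n.
have L0 : 0 < ln C%:R :> R by rewrite ln_gt0// ltr1n.
have lam0 : 0 < C%:R `^ gamma by exact: powR_gt0.
rewrite lnM ?posrE ?exprn_gt0 ?mulr_gt0 ?expR_gt0 ?invr_gt0//.
rewrite lnXn ?mulr_gt0 ?expR_gt0 ?invr_gt0//.
rewrite !lnM ?posrE ?mulr_gt0 ?expR_gt0 ?invr_gt0//.
rewrite expRK lnV ?posrE// ln_powR -(mulr_natl (1 + _)) natrM.
by field; rewrite !gt_eqF.
Qed.

(** * Limits and the diversity gain *)

Lemma ln_natr_cvgy (R : realType) : (ln n%:R : R) @[n --> \oo] --> +oo.
Proof.
apply/cvgryPge => A; near=> n; rewrite -[A]expRK ler_ln ?posrE ?expR_gt0//.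
  near: n; exact: nbhs_infty_ger.
by rewrite (lt_le_trans (expR_gt0 A))//; near: n; exact: nbhs_infty_ger.
Unshelve. all: by end_near. Qed.

Lemma cvg_inv_ln_natr (R : realType) : ((ln n%:R)^-1 : R) @[n --> \oo] --> 0.
Proof.
apply/gtr0_cvgV0; last exact: ln_natr_cvgy.
near=> n; rewrite ln_gt0// ltr1n; near: n; exact: nbhs_infty_gt.
Unshelve. all: by end_near. Qed.

Lemma cvg_inv_natr (R : realType) : (n%:R^-1 : R) @[n --> \oo] --> 0.
Proof.
apply/gtr0_cvgV0; last exact: cvgr_idn.
by near=> n; rewrite ltr0n; near: n; exact: nbhs_infty_gt.
Unshelve. all: by end_near. Qed.

Theorem lemma2 (R : realType) (gamma : R) (Tmin Tmax : nat) (p : nat -> R)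
    (d : nat -> measure_display) (T : forall C : nat, measurableType (d C))
    (P : forall C : nat, probability (T C) R)
    (Q : forall C : nat, nat -> {RV (P C) >-> nat})
    (tau : forall C : nat, nat -> nat -> {RV (P C) >-> nat})
    (gamma_ge0 : 0 <= gamma) (gamma_le1 : gamma <= 1)
    (le_Tmin_Tmax : (Tmin <= Tmax)%N)
    (p_Tmin_gt0 : 0 < p Tmin)
    (requests : forall C : nat, (0 < C)%N ->
       iid_poisson_requests (C%:R `^ gamma)
         (fun k => if (Tmin <= k <= Tmax)%N then p k else 0)
         (Q C) (tau C)) :
  (forall C : nat, (0 < C)%N -> cvgn (outage_prob C (Q C) (tau C))) /\
  ((- lne (steady_outage_prob C (Q C) (tau C)) / (C%:R * ln C%:R)%:E)%E
     @[C --> \oo] --> ((1 + Tmin%:R) * (1 - gamma))%:E).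
Proof.
have cvg_outage C : (0 < C)%N -> cvgn (outage_prob C (Q C) (tau C)).
  move=> C0; apply: ereal_nondecreasing_is_cvgn.
  exact: outage_prob_nondecreasing (requests C C0).
split => //.
pose F C := (- lne (steady_outage_prob C (Q C) (tau C)) / (C%:R * ln C%:R)%:E)%E.
pose upper C : R := (Tmin.+1%:R + C%:R^-1) *
    ((1 - gamma) + (ln Tmin.+2%:R - ln (p Tmin)) / ln C%:R) + (ln C%:R)^-1.
pose lower C : R := if gamma == 1 then 0 else
  Tmin.+1%:R * ((1 - gamma) - (ln C%:R)^-1) - ln 2 * C%:R^-1 * (ln C%:R)^-1.
have upper_cvg : upper C @[C --> \oo] --> (1 + Tmin%:R) * (1 - gamma).
  rewrite (_ : _ * _ = (Tmin.+1%:R + 0) *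
    ((1 - gamma) + (ln Tmin.+2%:R - ln (p Tmin)) * 0) + 0); last first.
    by rewrite -natr1; ring.
  apply: cvgD; last exact: cvg_inv_ln_natr.
  apply: cvgM; apply: cvgD; [exact: cvg_cst|exact: cvg_inv_natr|exact: cvg_cst|].
  by apply: cvgMr; exact: cvg_inv_ln_natr.
have lower_cvg : lower C @[C --> \oo] --> (1 + Tmin%:R) * (1 - gamma).
  rewrite /lower; case: eqP => [->|_].
    by rewrite subrr mulr0; exact: cvg_cst.
  rewrite (_ : _ * _ = Tmin.+1%:R * ((1 - gamma) - 0) - ln 2 * 0 * 0); last first.
    by rewrite -natr1; ring.
  apply: cvgB; last by apply: cvgM; [apply: cvgMr; exact: cvg_inv_natr|
    exact: cvg_inv_ln_natr].
  apply: cvgMr; apply: cvgB; [exact: cvg_cst|exact: cvg_inv_ln_natr].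
have small : \forall C \near \oo, gamma != 1 ->
    expR 1 * (C%:R `^ gamma / C%:R) <= 2^-1 :> R.
  have [->|g1] := eqVneq gamma 1; first by apply: nearW.
  have {}g1 : 0 < 1 - gamma by rewrite subr_gt0 lt_neqAle g1.
  near=> C => _; have C0 : 0 < C%:R :> R.
    by rewrite ltr0n; near: C; exact: nbhs_infty_gt.
  rewrite /powR gt_eqF// -[X in _ / X]lnK ?posrE// -expRN -!expRD.
  rewrite -[leRHS]lnK ?posrE ?invr_gt0// ler_expR lnV ?posrE//.
  (* The logarithm of e C^(gamma - 1) <= 1 / 2, solved for ln C. *)
  have : (1 + ln 2) / (1 - gamma) <= ln C%:R :> R.
    by near: C; move: (ln_natr_cvgy R) => /cvgryPge; exact.
  by rewrite ler_pdivrMr//; lra.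
have bounds : \forall C \near \oo, F C \is a fin_num /\
    lower C <= fine (F C) <= upper C.
  near=> C.
  have C1 : (1 < C)%N by near: C; exact: nbhs_infty_gt.
  have Cgt0 : (0 < C)%N by exact: ltnW.
  have C0 : 0 < C%:R :> R by rewrite ltr0n.
  have CL : 0 < C%:R * ln C%:R :> R by rewrite mulr_gt0// ln_gt0// ltr1n.
  have lam0 : 0 < C%:R `^ gamma by exact: powR_gt0.
  have req := requests C Cgt0.
  have smallC : gamma != 1 -> expR 1 * (C%:R `^ gamma / C%:R) <= 2^-1 :> R.
    by near: C.
  set l := poisson_pmf (C%:R `^ gamma) (Tmin.+1 * C).+1 * p Tmin ^+ (Tmin.+1 * C).+1.
  have l0 : 0 < l.
    rewrite mulr_gt0 ?exprn_gt0// /poisson_pmf lam0.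
    by rewrite mulr_gt0 ?expR_gt0 ?divr_gt0 ?exprn_gt0// ltr0n fact_gt0.
  have ge_l : (l%:E <= steady_outage_prob C (Q C) (tau C))%E.
    apply: lime_ge; first exact: cvg_outage.
    near=> n; have := outage_prob_ge _ _ _ _ _ _ _ _ C Tmin n req.
    rewrite leqnn le_Tmin_Tmax /=; apply.
    near: n; exact: nbhs_infty_gt.
  have le_1 : (steady_outage_prob C (Q C) (tau C) <= 1)%E.
    apply: lime_le; first exact: cvg_outage.
    by near=> n; apply: probability_le1; exact: measurable_outage.
  (* Between the positive real [l] and 1 the steady-state probability is a positive real, so [lne]
     reduces to [ln]. *)
  have [f fE] : exists f, steady_outage_prob C (Q C) (tau C) = f%:E.
    by move: ge_l le_1; case: steady_outage_prob => // f; exists f.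
  have f1 : f <= 1 by rewrite -lee_fin -fE.
  have lf : l <= f by rewrite -lee_fin -fE.
  have f0 : 0 < f by exact: lt_le_trans lf.
  have FE : F C = (- ln f / (C%:R * ln C%:R))%:E.
    by rewrite /F fE lne_EFin// inver gt_eqF// -EFinN -EFinM.
  rewrite FE; split => //=; apply/andP; split.
    rewrite /lower; case: eqP => [_|/eqP g1].
      by rewrite divr_ge0 ?(ltW CL)// oppr_ge0 ln_le0.
    rewrite -ln_outage_bound// ler_pM2r ?invr_gt0// lerN2 ler_ln ?posrE//.
      rewrite -lee_fin -fE; apply: lime_le; first exact: cvg_outage.
      near=> n; apply: outage_prob_le req _ _ _ _ => //.
        by move=> k kT; rewrite leqNgt kT.
      exact: smallC.
    by rewrite mulr_gt0// exprn_gt0// mulr_gt0 ?expR_gt0// divr_gt0.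
  rewrite (le_trans _ (ln_poisson_burst _ gamma (p Tmin) C Tmin _ _ _ _ _ erefl))//.
  by rewrite ler_pM2r ?invr_gt0// lerN2 ler_ln.
apply/fine_cvgP; split; first by apply: filterS bounds => C [].
apply: squeeze_cvgr lower_cvg upper_cvg.
by apply: filterS bounds => C [].
Unshelve. all: by end_near. Qed.
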